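(* Let $\mathcal{A}_n$ be either $\mathcal{C}_{n,A}$ or $\mathcal{C}^*_{n,A}$, $n\ge1$. Then \[\chi_{\mathcal{A}_n}(t)=\sum_{\ell=0}^n(-1)^{n-\ell}\, r_\ell(\mathcal{A}_n)\binom{t}{\ell},\] where $\binom{t}{\ell}=t(t-1)\cdots(t-\ell+1)/\ell!$.
   Context: Let $A=\{a_1,\dots,a_m\}$ with $a_1>\dots>a_m>0$. $\mathcal{C}_{n,A}$ is the arrangement in $\mathbb{R}^n$ of hyperplanes $x_i-x_j=0$ ($i<j$) and $x_i-x_j=a_k$ ($i\ne j$, $1\le k\le m$); $\mathcal{C}^*_{n,A}$ is the arrangement of hyperplanes $x_i-x_j=a_k$ ($i\ne j$, $1\le k\le m$). The characteristic polynomial of an arrangement $\mathcal{A}$ in $\mathbb{R}^n$ is $\chi_{\mathcal{A}}(t)=\sum_{x\in\mathcal{L}(\mathcal{A})}\mu(\hat 0,x)t^{\dim x}$, where $\mathcal{L}(\mathcal{A})$ is the poset of nonempty intersections of hyperplanes of $\mathcal{A}$ (including $\mathbb{R}^n=\hat0$) ordered by reverse inclusion and $\mu$ is its Möbius function. Regions are connected components of the complement of the union of the hyperplanes. The level of $X\subseteq\mathbb{R}^n$ is the smallest integer $\ell\ge0$ such that there are a linear subspace $W$ of dimension $\ell$ and $r>0$ with $X\subseteq\{\bm x:\min_{\bm y\in W}\|\bm x-\bm y\|\le r\}$. $r_\ell(\mathcal{A})$ is the number of regions of level $\ell$. *)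

(* Defs.v *)
From HB Require Import structures.
From mathcomp Require Import all_boot all_order all_algebra.
From mathcomp Require Import all_classical all_reals all_analysis.
Set Implicit Arguments. Unset Strict Implicit. Unset Printing Implicit Defensive.
Import Order.TTheory GRing.Theory Num.Theory.
Import numFieldNormedType.Exports.
Local Open Scope classical_set_scope.
Local Open Scope ring_scope.

Section Arr.
Variables (R : realType) (n : nat).
Notation V := 'rV[R]_n.

Definition arrC (A : seq R) : set (set V) :=
  [set H | (exists i j : 'I_n, (i < j)%N /\ H = [set x : V | x 0 i - x 0 j = 0])
        \/ (exists (i j : 'I_n) (a : R), i != j /\ a \in A /\
              H = [set x : V | x 0 i - x 0 j = a])].

Definition arrCstar (A : seq R) : set (set V) :=
  [set H | exists (i j : 'I_n) (a : R), i != j /\ a \in A /\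
              H = [set x : V | x 0 i - x 0 j = a]].

(* intersection poset L(Arr): nonempty intersections of subfamilies
   (the empty subfamily gives R^n) *)
Definition intposet (Arr : set (set V)) : set (set V) :=
  [set X | exists B : set (set V), B `<=` Arr /\ X = \bigcap_(H in B) H /\ X !=set0].

(* Moebius function mu(0hat, x), 0hat = R^n, order = reverse inclusion:
   mu(0hat,0hat) = 1,  mu(0hat,x) = - sum_{0hat <= y < x} mu(0hat,y).
   Defined by recursion with fuel; chains in L have length <= n, so
   fuel n.+1 suffices. *)
Fixpoint mob_fuel (L : set (set V)) (k : nat) (x : set V) : int :=
  match k with
  | 0%N => 0
  | k'.+1 => if pselect (x = setT) then 1
             else - \sum_(y \in [set y | L y /\ x `<` y]) mob_fuel L k' y
  end.

Definition mobius (Arr : set (set V)) (x : set V) : int :=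
  mob_fuel (intposet Arr) n.+1 x.

Definition is_affdim (X : set V) (d : nat) : Prop :=
  exists (p : V) (M : 'M[R]_(d, n)), \rank M = d /\
    X = [set p + y | y in [set y : V | (y <= M)%MS]].

Definition affdim (X : set V) : nat := xget 0%N [set d | is_affdim X d].

Definition charpoly (Arr : set (set V)) : {poly R} :=
  \sum_(x \in intposet Arr) (((mobius Arr x)%:~R : R) *: 'X^(affdim x)).

Definition complement (Arr : set (set V)) : set V :=
  ~` (\bigcup_(H in Arr) H).

Definition region (Arr : set (set V)) (C : set V) : Prop :=
  exists2 x, complement Arr x & C = connected_component (complement Arr) x.

Definition sqnorm (v : V) : R := \sum_(i < n) v 0 i ^+ 2.

Definition near_subspace (X : set V) (l : nat) : Prop :=
  exists (M : 'M[R]_(l, n)), \rank M = l /\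
    exists2 r : R, 0 < r & forall x, X x ->
      exists y : V, (y <= M)%MS /\ sqnorm (x - y) <= r ^+ 2.

Definition has_level (X : set V) (l : nat) : Prop :=
  near_subspace X l /\ forall k, near_subspace X k -> (l <= k)%N.

Definition nregions (Arr : set (set V)) (l : nat) : nat :=
  (\sum_(C \in [set C | region Arr C /\ has_level C l]) 1)%N.

End Arr.

Definition binom_poly (R : realType) (l : nat) : {poly R} :=
  (l`!%:R)^-1 *: \prod_(i < l) ('X - (i%:R)%:P).

Arguments arrC {R} n A.
Arguments arrCstar {R} n A.

(* Main.v *)
Require Import Defs.
From HB Require Import structures.
From mathcomp Require Import all_boot all_order all_algebra.
From mathcomp Require Import all_classical all_reals all_analysis.
From mathcomp Require Import lra ring zify.
Set Implicit Arguments. Unset Strict Implicit. Unset Printing Implicit Defensive.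
Import Order.TTheory GRing.Theory Num.Theory.
Import numFieldNormedType.Exports.
Local Open Scope classical_set_scope.
Local Open Scope ring_scope.

(* Both sides are polynomials, so it is enough to compare them at t = -(m+1)
   for every natural number m.  For a direction c in {0, ..., m}^n, let N go to
   infinity in the identity [complement] = sum_X mu(X) [X] evaluated at x + N c:
   a flat X survives (as itself) iff c is parallel to X, and a region C becomes
   an open convex set, nonempty iff c is in the recession cone of C.  Taking
   Euler characteristics with compact support, (-1)^d for a relatively open
   convex set of dimension d, gives
     sum_(X parallel to c) mu(X) (-1)^(dim X) = (-1)^n #{C | c recedes in C}.
   Now sum over c.  The coordinates of c must be constant on the blocks of X,
   which gives (m+1)^(dim X) directions.  With a the largest element of A and x a
   point of C, they must satisfy c_i <= c_j whenever x_i - x_j < a: this relation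
   generates a total preorder with l classes, l being the level of C, so that
   there are binomial(l + m, l) = (-1)^l binomial(-(m+1), l) directions. *)

Lemma mem_fset_set (T : choiceType) (A : set T) (x : T) :
  finite_set A -> x \in finmap.enum_fset (fset_set A) -> A x.
Proof. by move=> fA xA; apply: set_mem; rewrite -(in_fset_set fA x). Qed.

(** * Euler characteristic of relatively open convex sets *)

Lemma common_radius (R : realType) (I : eqType) (s : seq I) (Q : I -> R -> Prop) :
  (forall q, q \in s -> exists2 d, 0 < d & forall t, `|t| < d -> Q q t) ->
  exists2 d, 0 < d & forall q, q \in s -> forall t, `|t| < d -> Q q t.
Proof.
elim: s => [|q s IH] Hs; first by exists 1.
have [d d0 Hd] := Hs q (mem_head _ _).
have [|d' d'0 Hd'] := IH; first by move=> p ps; apply: Hs; rewrite inE ps orbT.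
exists (Num.min d d'); first by rewrite lt_min d0.
move=> p; rewrite inE => /orP[/eqP-> t|ps t]; rewrite lt_min => /andP[td td'].
  exact: Hd.
exact: Hd'.
Qed.

Lemma common_threshold (I : eqType) (s : seq I) (Q : I -> nat -> Prop) :
  (forall q, q \in s -> exists N0, forall N, (N0 <= N)%N -> Q q N) ->
  exists N0, forall q, q \in s -> forall N, (N0 <= N)%N -> Q q N.
Proof.
elim: s => [|q s IH] Hs; first by exists 0%N.
have [d Hd] := Hs q (mem_head _ _).
have [|d' Hd'] := IH; first by move=> p ps; apply: Hs; rewrite inE ps orbT.
exists (maxn d d') => p; rewrite inE => /orP[/eqP-> t|ps t];
  rewrite geq_max => /andP[td td']; [exact: Hd|exact: Hd'].
Qed.

(** * Intervals of the real line *)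

Section EulerLine.
Variable R : realType.
Implicit Types (I : set R) (x : R).

(** This is the Euler characteristic with compact support, for the only sets in which a line can
    meet a relatively open convex set: the empty set, a point, a nonempty open interval. *)
Inductive euler_char1 : set R -> int -> Prop :=
| EulerEmpty : euler_char1 set0 0
| EulerPoint x : euler_char1 [set x] 1
| EulerOpen I : I !=set0 -> is_interval I ->
    (forall x, I x -> exists2 d, 0 < d & forall t, `|t| < d -> I (x + t)) ->
    euler_char1 I (-1).

Definition right_germ I x := exists2 d, 0 < d & forall t, 0 < t -> t < d -> I (x + t).

Definition unbounded_below I := forall x, exists2 y, y < x & I y.

Lemma euler_char1_interval I e : euler_char1 I e -> is_interval I.
Proof.
case=> {I e} [|p|//]; first by move=> x y [].
by move=> x y -> -> z /andP[zx zy]; apply/eqP; rewrite eq_le zx zy.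
Qed.

Lemma right_germN I x : is_interval I -> ~ right_germ I x ->
  exists2 d, 0 < d & forall t, 0 < t -> t < d -> ~ I (x + t).
Proof.
move=> itvI nrg; apply: contrapT => H; apply: nrg.
have H' d : 0 < d -> exists t, [/\ 0 < t, t < d & I (x + t)].
  move=> d0; apply: contrapT => K; apply: H; exists d => // t t0 td It.
  by apply: K; exists t.
have [d [d0 _ Id]] := H' 1 ltr01.
exists d => // t t0 td; have [u [u0 ut Iu]] := H' t t0.
by apply: (itvI _ _ Iu Id); rewrite !lerD2l !ltW.
Qed.

(** An indicator function of an interval is constant near -oo, and [unbounded_below] is its value
    there. *)
Lemma unbounded_belowP I : is_interval I -> exists b, forall y, y < b ->
  `[< I y >] = `[< unbounded_below I >].
Proof.
move=> itvI; have [H|H] := asboolP (unbounded_below I).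
  have [b _ Ib] := H 0; exists b => y yb; apply/asboolP.
  have [z zy Iz] := H y; by apply: (itvI _ _ Iz Ib); rewrite !ltW.
have [b Hb] : exists b, forall y, y < b -> ~ I y.
  apply: contrapT => K; apply: H => x; apply: contrapT => L; apply: K.
  by exists x => y yx Iy; apply: L; exists y.
by exists b => y yb; apply/asboolPn; apply: Hb.
Qed.

(* Euler characteristic as the total jump of the indicator function, the
   starting value at -oo being counted as a jump as well. *)
Lemma euler_char1_jump I e : euler_char1 I e -> exists p,
  (forall x, x != p -> `[< I x >] = `[< right_germ I x >]) /\
  e = (`[< I p >]%:R - `[< right_germ I p >]%:R) - `[< unbounded_below I >]%:R.
Proof.
case=> {I e} [|p|I [x0 Ix0] itvI openI].
- exists 0; have H x : `[<right_germ set0 x>] = false.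
    by apply/asboolPn => -[d d0 /(_ (d/2))]; apply; lra.
  have -> : `[<unbounded_below set0>] = false.
    by apply/asboolPn => /(_ 0) [].
  by split=> [x _|]; rewrite ?H asboolF.
- exists p; have H x : `[<right_germ [set p] x>] = false.
    apply/asboolPn => -[d d0 K].
    have /= K1 := K (d/2) ltac:(lra) ltac:(lra).
    have /= K2 := K (d/3) ltac:(lra) ltac:(lra).
    lra.
  have -> : `[<unbounded_below [set p]>] = false.
    by apply/asboolPn => /(_ p) [y yp /= yE]; move: yp; rewrite yE ltxx.
  split=> [x xp|]; rewrite H; last by rewrite asboolT.
  by apply/asboolPn => /= xE; rewrite xE eqxx in xp.
- have Irg x : I x -> right_germ I x.
    move=> Ix; have [d d0 Hd] := openI x Ix.
    by exists d => // t t0 td; apply: Hd; rewrite gtr0_norm.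
  (* Such a p is the left endpoint of the open interval, and the only jump is there; a right
     endpoint is no jump, the value and the right germ both being 0. *)
  have [[p [nIp rgp]]|nend] := pselect (exists p, ~ I p /\ right_germ I p).
    exists p; split=> [x xp|]; last first.
      rewrite (asboolF nIp) (asboolT rgp) asboolF //= => /(_ p) [y yp Iy].
      have [d d0 Hd] := rgp; apply: nIp.
      apply: (itvI _ _ Iy (Hd (d/2) _ _)); [lra|lra|].
      by apply/andP; split; lra.
    apply/asbool_equiv_eq; split; first exact: Irg.
    move=> rgx; apply: contrapT => nIx.
    (* There is only one left endpoint: v lies between points of [I] just right of u and points of
       [I] just right of v. *)
    have noway u v : u < v -> right_germ I u -> right_germ I v -> ~ ~ I v.
      move=> uv [d d0 Hd] [d' d'0 Hd']; apply.
      pose w := Num.min (d/2) (v - u).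
      have w0 : 0 < w by rewrite lt_min; apply/andP; split; lra.
      have w1 : w <= d/2 by rewrite ge_min lexx.
      have w2 : w <= v - u by rewrite ge_min lexx orbT.
      apply: (itvI _ _ (Hd w w0 _) (Hd' (d'/2) _ _)); [lra|lra|lra|].
      by apply/andP; split; lra.
    by case/orP: (lt_total xp) => ?; [apply: (noway x p)|apply: (noway p x)].
  have rgE x : `[<I x>] = `[<right_germ I x>].
    apply/asbool_equiv_eq; split; first exact: Irg.
    by move=> rgx; apply: contrapT => nIx; apply: nend; exists x.
  (* Without a left endpoint any p does, and the jump is at -oo: if [I] were bounded below, [inf I]
     would be a left endpoint. *)
  exists 0; split=> //; rewrite rgE subrr asboolT // => x.
  apply: contrapT => nx.
  have lbI : lbound I x.
    by move=> y Iy; rewrite leNgt; apply/negP => yx; apply: nx; exists y.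
  have hI : has_inf I by split; [exists x0|exists x].
  have nIinf : ~ I (inf I).
    move=> Iinf; have [d d0 Hd] := openI _ Iinf.
    have := ge_inf hI.2 (Hd (- (d/2)) _); rewrite normrN gtr0_norm; last lra.
    by move=> K; have := K ltac:(lra); lra.
  apply: nend; exists (inf I); split=> //.
  have infx0 : inf I < x0.
    rewrite lt_neqAle (ge_inf hI.2 Ix0) andbT; apply/eqP => E.
    by apply: nIinf; rewrite E.
  exists (x0 - inf I); first lra.
  move=> t t0 t1; have [y Iy yt] := inf_adherent t0 hI.
  by apply: (itvI _ _ Iy Ix0); apply/andP; split; lra.
Qed.

(** A linear relation between indicator functions passes to their right germs and to their values at
    -oo, hence to their jumps, whose sum is the Euler characteristic. *)
Lemma euler_char1_linear (J : finType) (m e : J -> int) (F : J -> set R) :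
  (forall j, euler_char1 (F j) (e j)) ->
  (forall x, \sum_j m j * `[< F j x >]%:R = 0) ->
  \sum_j m j * e j = 0.
Proof.
move=> eF F0.
have itvF j := euler_char1_interval (eF j).
have germ0 x : \sum_j m j * `[< right_germ (F j) x >]%:R = 0.
  have [d d0 Hd] : exists2 d, 0 < d & forall j, j \in enum J -> forall t,
      `|t| < d -> 0 < t -> `[< F j (x + t) >] = `[< right_germ (F j) x >].
    apply: (@common_radius R J (enum J)
      (fun j t => 0 < t -> `[< F j (x + t) >] = `[< right_germ (F j) x >])).
    move=> j _; have [rg|nrg] := pselect (right_germ (F j) x).
      have [d d0 Hd] := rg; exists d => // t td t0.
      by rewrite !asboolT //; apply: Hd => //; rewrite gtr0_norm in td.
    have [d d0 Hd] := right_germN (itvF j) nrg; exists d => // t td t0.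
    by rewrite !asboolF //; apply: Hd => //; rewrite gtr0_norm in td.
  rewrite -[RHS](F0 (x + d/2)); apply: eq_bigr => j _.
  by rewrite Hd ?mem_enum //; [rewrite gtr0_norm; lra|lra].
have unb0 : \sum_j m j * `[< unbounded_below (F j) >]%:R = 0.
  have [b Hb] : exists b, forall j y, y < b ->
      `[< F j y >] = `[< unbounded_below (F j) >].
    have /choice [b Hb] : forall j, exists b, forall y, y < b ->
      `[< F j y >] = `[< unbounded_below (F j) >].
      by move=> j; apply: unbounded_belowP.
    have [b0 Hb0] : exists b0, forall j, j \in enum J -> b0 <= b j.
      elim: (enum J) => [|j s [b0 Hs]]; first by exists 0.
      exists (Num.min b0 (b j)) => i; rewrite inE => /orP[/eqP->|/Hs H].
        by rewrite ge_min lexx orbT.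
      by rewrite ge_min H.
    by exists b0 => j y yb; apply: Hb; apply: lt_le_trans yb (Hb0 _ _);
      rewrite mem_enum.
  rewrite -[RHS](F0 (b - 1)); apply: eq_bigr => j _; rewrite Hb //; lra.
have /choice [p Hp] := fun j => euler_char1_jump (eF j).
pose jump j x : int := `[< F j x >]%:R - `[< right_germ (F j) x >]%:R.
(* A common finite set of possible jumps, so that the sums over j and over the jumps can be
   exchanged. *)
pose S := undup (map p (enum J)).
have eE j : e j = \sum_(x <- S) jump j x - `[< unbounded_below (F j) >]%:R.
  rewrite (Hp j).2 (bigD1_seq (p j)) ?undup_uniq //=; last first.
    by rewrite mem_undup map_f // mem_enum.
  rewrite big1 ?addr0 // => x xp.
  by rewrite /jump ((Hp j).1 x xp) subrr.
under eq_bigr do rewrite eE mulrBr mulr_sumr.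
rewrite sumrB unb0 subr0 exchange_big /= big1 // => x _.
by under eq_bigr do rewrite mulrBr; rewrite sumrB F0 germ0 subrr.
Qed.

End EulerLine.

(** * Reduction of dimension n to lines *)

Section EulerSpace.
Variables (R : realType) (n : nat).
Notation V := 'rV[R]_n.
Implicit Types (P : set V) (M : 'M[R]_n) (k : 'I_n).
Notation basis k := (delta_mx 0 k : V).

(** [P] is nonempty, convex and relatively open in a translate of the row space of [M], so its
    dimension is the rank of [M]. Openness is only asked along lines, which is how it is applied. *)
Definition relopen_convex P M :=
  [/\ P !=set0,
      forall x y t, P x -> P y -> 0 <= t -> t <= 1 -> P (x + t *: (y - x)),
      forall x y, P x -> P y -> (y - x <= M)%MS &
      forall x v, P x -> (v <= M)%MS ->
        exists2 d, 0 < d & forall t, `|t| < d -> P (x + t *: v)].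

(** The projection of [P] along a basis vector, kept in the same space as the union of the lines
    that meet [P]. *)
Definition cylinder k P := [set x : V | exists s, P (x + s *: basis k)].

Lemma cylinder_relopen_convex k P M :
  relopen_convex P M -> relopen_convex (cylinder k P) (M + basis k)%MS.
Proof.
case=> [[x0 Px0] cvxP subP openP]; split.
- by exists x0; exists 0; rewrite scale0r addr0.
- move=> x y t [a Pa] [b Pb] t0 t1; exists (a + t * (b - a)).
  have := cvxP _ _ _ Pa Pb t0 t1; congr P.
  apply/rowP => i; rewrite !mxE; ring.
- move=> x y [a Pa] [b Pb].
  have -> : y - x = (y + b *: basis k - (x + a *: basis k)) + (a - b) *: basis k.
    by apply/rowP => i; rewrite !mxE; ring.
  apply: addmx_sub_adds; [exact: subP|exact: scalemx_sub].
- move=> x v [a Pa] /sub_addsmxP[[u1 u2] /= ->].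
  have [d d0 Hd] := openP _ _ Pa (submxMl u1 M); exists d => // t td.
  exists (a - t * u2 0 0); have := Hd t td; congr P.
  rewrite [in RHS](mx11_scalar u2) mul_scalar_mx.
  by apply/rowP => i; rewrite !mxE eqxx mulr1n; ring.
Qed.

Lemma fiber_euler_char1 k P M x : relopen_convex P M ->
  euler_char1 [set s | P (x + s *: basis k)]
    ((-1) ^+ (basis k <= M)%MS * `[< cylinder k P x >]%:R).
Proof.
case=> [_ cvxP subP openP].
have [[s0 Ps0]|nP] := asboolP (cylinder k P x); last first.
  rewrite mulr0.
  suff -> : [set s | P (x + s *: basis k)] = set0 by exact: EulerEmpty.
  by apply/seteqP; split=> // s Ps; apply: nP; exists s.
rewrite mulr1; have [kM|kM] := boolP (basis k <= M)%MS; last first.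
  suff -> : [set s | P (x + s *: basis k)] = [set s0] by exact: EulerPoint.
  apply/seteqP; split=> [s Ps|s -> //] /=; apply: contrapT => /eqP ss0.
  have := subP _ _ Ps0 Ps; rewrite opprD addrACA subrr add0r -scalerBl.
  by rewrite eqmx_scale ?subr_eq0 // => /(negP kM).
apply: EulerOpen; first by exists s0.
- move=> a b /= Pa Pb z /andP[az zb].
  have [E|ab] := eqVneq a b; first by have -> : z = a by lra.
  have ab' : 0 < b - a by rewrite subr_gt0 lt_neqAle ab (le_trans az).
  have := cvxP _ _ ((z - a) / (b - a)) Pa Pb.
  rewrite opprD addrACA subrr add0r -scalerBl -addrA scalerA -scalerDl.
  rewrite mulfVK ?gt_eqF // subrKC; apply.
    by apply: divr_ge0; [lra|exact: ltW].
  by rewrite ler_pdivrMr //; lra.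
- move=> s /= Ps; have [d d0 Hd] := openP _ _ Ps kM; exists d => // t /Hd.
  by rewrite -addrA -scalerDl.
Qed.

(* Integrating the indicator functions over the lines parallel to a basis
   vector multiplies each coefficient by the Euler characteristic of the fibers. *)
Lemma cylinder_linear k (J : finType) (m : J -> int) (P_ : J -> set V)
    (M_ : J -> 'M[R]_n) :
  (forall j, relopen_convex (P_ j) (M_ j)) ->
  (forall x, \sum_(j : J) m j * `[< P_ j x >]%:R = 0) ->
  forall x, \sum_j (m j * (-1) ^+ (basis k <= M_ j)%MS)
              * `[< cylinder k (P_ j) x >]%:R = 0.
Proof.
move=> HP P0 x; under eq_bigr do rewrite -mulrA.
apply: euler_char1_linear (fun j => fiber_euler_char1 k x (HP j)) _ => s.
exact: P0.
Qed.

Definition translation_invariant k P :=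
  forall x s, P x -> P (x + s *: basis k).

Lemma translation_invariant_cylinder k P : translation_invariant k (cylinder k P).
Proof.
by move=> x s [a Pa]; exists (a - s); rewrite -addrA -scalerDl subrKC.
Qed.

Lemma translation_invariantW k k' P :
  translation_invariant k P -> translation_invariant k (cylinder k' P).
Proof.
by move=> invP x s [a Pa]; exists a; rewrite addrAC; apply: invP.
Qed.

Lemma invariant_setT P : P !=set0 -> (forall k, translation_invariant k P) -> P = setT.
Proof.
case=> x0 Px0 invP; apply/seteqP; split=> // x _.
have -> : x = x0 + \sum_(k <- enum 'I_n) (x - x0) 0 k *: basis k.
  by rewrite big_enum /= -row_sum_delta subrKC.
elim: (enum _) x0 Px0 (x - x0) => [|k s IH] y Py v; first by rewrite big_nil addr0.
by rewrite big_cons addrA; apply: IH; apply: invP.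
Qed.

(** Induction on the coordinates not yet integrated out. If the basis vector lies in [M_ j], the
    coefficient changes sign and the rank stays; otherwise the coefficient stays and the rank grows
    by one. Either way the term changes sign. In the end every set is the whole space and the
    coefficients add up to 0. *)
Lemma euler_char_linear_aux (ks : seq 'I_n) (J : finType) (m : J -> int)
    (P_ : J -> set V) (M_ : J -> 'M[R]_n) :
  (forall j, relopen_convex (P_ j) (M_ j)) ->
  (forall j k, k \notin ks -> translation_invariant k (P_ j)) ->
  (forall x, \sum_(j : J) m j * `[< P_ j x >]%:R = 0) ->
  \sum_j m j * (-1) ^+ (\rank (M_ j)) = 0.
Proof.
elim: ks m P_ M_ => [|k ks IH] m P_ M_ HP invP P0.
  have PT j : P_ j = setT.
    by apply: invariant_setT; [case: (HP j)|move=> k; apply: invP].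
  have rkM j : \rank (M_ j) = n.
    apply/eqP; rewrite -[_ == _]/(row_full (M_ j)) -sub1mx; apply/row_subP => i.
    by rewrite -[row _ _]subr0; case: (HP j) => _ _ -> //; rewrite PT.
  have := P0 0; rewrite (eq_bigr m) => [m0|j _]; last first.
    by rewrite asboolT ?mulr1 // PT.
  by under eq_bigr do rewrite rkM; rewrite -mulr_suml m0 mul0r.
have := IH _ _ _ (fun j => cylinder_relopen_convex k (HP j)) _
  (cylinder_linear k HP P0).
rewrite (eq_bigr (fun j => - (m j * (-1) ^+ \rank (M_ j)))) => [|j _]; last first.
  case: (boolP (basis k <= M_ j)%MS) => kM.
    by rewrite (addsmx_idPl kM) expr1 mulrN1 mulNr.
  suff -> : \rank (M_ j + basis k)%MS = (\rank (M_ j)).+1.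
    by rewrite expr0 mulr1 exprS mulN1r mulrN.
  rewrite mxrank_disjoint_sum ?mxrank_delta ?addn1 //.
  apply/eqP/rowV0P => v; rewrite sub_capmx => /andP[vM /sub_rVP[a va]].
  rewrite va; have [->|a0] := eqVneq a 0; first by rewrite scale0r.
  by case/negP: kM; rewrite -(eqmx_scale _ a0) -va.
rewrite sumrN => H; apply/eqP; rewrite -oppr_eq0 H //.
move=> j i iks; have [->|ik] := eqVneq i k.
  exact: translation_invariant_cylinder.
by apply/translation_invariantW/invP; rewrite inE negb_or ik.
Qed.

(** The list form lets flats and regions enter one and the same relation. *)
Lemma euler_char_linear (l : seq (int * set V * 'M[R]_n)) :
  (forall q, q \in l -> relopen_convex q.1.2 q.2) ->
  (forall x, \sum_(q <- l) q.1.1 * `[< q.1.2 x >]%:R = 0) ->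
  \sum_(q <- l) q.1.1 * (-1) ^+ \rank q.2 = 0.
Proof.
move=> Hl l0; rewrite big_tnth.
apply: (euler_char_linear_aux (ks := enum 'I_n)
  (P_ := fun j => (tnth (in_tuple l) j).1.2)) => [j|j k|x].
- exact/Hl/mem_tnth.
- by rewrite mem_enum.
- by rewrite -[RHS](l0 x) [RHS]big_tnth.
Qed.

End EulerSpace.

(** * Flats and the Moebius function *)

Section Directions.
Variables (R : realType) (n : nat).
Notation V := 'rV[R]_n.
Implicit Types (X Y : set V) (M N : 'M[R]_n).

(** [X] is a coset of the row space of [M]. *)
Definition is_direction X M :=
  X !=set0 /\ forall x v, X x -> (X (x + v) <-> (v <= M)%MS).

(** The dimension chosen by [xget] comes with a matrix whose row space must coincide with that of
    [M]. *)
Lemma is_direction_affdim X M : is_direction X M -> affdim X = \rank M.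
Proof.
case=> [[p Xp] dirX].
have X_affdim : is_affdim X (\rank M).
  exists p, (row_base M); split; first by rewrite eq_row_base.
  apply/seteqP; split=> [x Xx|_ [y /= yM <-]]; last first.
    by apply/dirX => //; rewrite -(eq_row_base M).
  exists (x - p); last by rewrite subrKC.
  by rewrite /= eq_row_base; apply/(dirX _ _ Xp); rewrite subrKC.
rewrite /affdim; case: xgetP => [d _ [q [N [rkN XE]]]|/(_ _ X_affdim) //].
have Xq : X q by rewrite XE; exists 0; rewrite ?addr0 //= sub0mx.
rewrite -rkN; apply/eqP; rewrite eqn_leq; apply/andP; split; apply: mxrankS;
  apply/row_subP => i.
  by apply/(dirX _ _ Xq); rewrite XE; exists (row i N) => //=; apply: row_sub.
have : X (q + row i M) by apply/dirX => //; apply: row_sub.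
by rewrite XE => -[y yN /addrI <-].
Qed.

Lemma is_direction_relopen X M : is_direction X M -> relopen_convex X M.
Proof.
case=> X0 dirX; have subX x y : X x -> X y -> (y - x <= M)%MS.
  by move=> Xx Xy; apply/(dirX x) => //; rewrite subrKC.
split=> // [x y t Xx Xy _ _|x v Xx vM].
  by apply/dirX => //; apply/scalemx_sub/subX.
by exists 1 => // t _; apply/dirX => //; apply: scalemx_sub.
Qed.

Lemma rank_direction_proper X Y M N : is_direction X M -> is_direction Y N ->
  X `<` Y -> (\rank M < \rank N)%N.
Proof.
move=> [[p Xp] dirX] [_ dirY] [XY YX].
have MN : (M <= N)%MS.
  apply/row_subP => i; apply/(dirY _ _ (XY _ Xp))/XY.
  by apply/dirX => //; apply: row_sub.
rewrite ltnNge; apply/negP => rkNM; apply: YX => y Yy.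
have NM : (N <= M)%MS by rewrite -(mxrank_leqif_sup MN) eqn_leq rkNM mxrankS.
have yN : (y - p <= N)%MS by apply/(dirY _ _ (XY _ Xp)); rewrite subrKC.
by rewrite -(subrKC p y); apply/dirX => //; apply: submx_trans NM.
Qed.

Definition direction X : 'M[R]_n := xget 0 [set M | is_direction X M].

End Directions.

Section Flats.
Variables (R : realType) (n : nat).
Notation V := 'rV[R]_n.
Notation hyperplane_index := ('I_n * 'I_n * R)%type.
Implicit Types (q : hyperplane_index) (s B : seq hyperplane_index).
Implicit Types (x v : V) (X Y : set V).

Definition gap q x : R := x 0 q.1.1 - x 0 q.1.2.

Lemma gapD q x y : gap q (x + y) = gap q x + gap q y.
Proof. by rewrite /gap !mxE; ring. Qed.

Lemma gapZ q a x : gap q (a *: x) = a * gap q x.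
Proof. by rewrite /gap !mxE; ring. Qed.

Definition hyperplane q : set V := [set x | gap q x = q.2].

Definition arrangement s : set (set V) :=
  [set H | exists2 q, q \in s & H = hyperplane q].

Definition flat B : set V := [set x | forall q, q \in B -> gap q x = q.2].

Definition flat_dir B : 'M[R]_n :=
  foldr (fun q M => kermx (delta_mx q.1.1 0 - delta_mx q.1.2 0 : 'cV_n) :&: M)%MS
    1%:M B.

Lemma flat_dirP B v :
  (v <= flat_dir B)%MS <-> forall q, q \in B -> gap q v = 0.
Proof.
elim: B => [|q B IH]; first by split=> // _; apply: submx1.
rewrite /= sub_capmx sub_kermx mulmxBr -!colE.
have -> : (col q.1.1 v - col q.1.2 v == 0) = (gap q v == 0).
  apply/eqP/eqP => [/colP/(_ 0)|E]; first by rewrite !mxE.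
  by apply/colP => i; rewrite !mxE !ord1.
split=> [/andP[/eqP Eq /IH EB] p|H].
  by rewrite inE => /orP[/eqP->//|/EB].
apply/andP; split; first by apply/eqP/H/mem_head.
by apply/IH => p pB; apply: H; rewrite inE pB orbT.
Qed.

Lemma flat_direction B : flat B !=set0 -> is_direction (flat B) (flat_dir B).
Proof.
move=> B0; split=> // x v Bx; rewrite flat_dirP.
split=> H q qB; have := H q qB; rewrite gapD (Bx q qB); first lra.
by move=> ->; rewrite addr0.
Qed.

Section Poset.
Variable s : seq hyperplane_index.
Hypothesis s_neq : forall q, q \in s -> q.1.1 != q.1.2.
Notation L := (intposet (arrangement s)).

Lemma flat_intposet B : {subset B <= s} -> flat B !=set0 -> L (flat B).
Proof.
move=> Bs B0; exists [set H | exists2 q, q \in B & H = hyperplane q]; split.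
  by move=> _ [q qB ->]; exists q => //; apply: Bs.
split=> //; apply/seteqP; split=> [x Bx _ [q qB ->]|x Bx q qB]; first exact: Bx.
by apply: (Bx (hyperplane q)); exists q.
Qed.

(** Encoding a subfamily by a boolean tuple exhibits [L] inside the image of a finite type. *)
Lemma intposet_mask X : L X ->
  exists2 m : (size s).-tuple bool, X !=set0 & X = flat (mask m s).
Proof.
move=> [B [Bs [XE X0]]].
exists (map_tuple (fun q => `[< B (hyperplane q) >]) (in_tuple s)) => //.
rewrite -filter_mask XE; apply/seteqP; split=> [x Bx q|x Bx H BH].
  by rewrite mem_filter => /andP[/asboolP/Bx].
have [q qs HE] := Bs _ BH; rewrite HE; apply: Bx.
by rewrite mem_filter qs andbT -HE; apply/asboolP.
Qed.

Lemma intposet_flat X : L X ->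
  exists B, [/\ {subset B <= s}, X !=set0 & X = flat B].
Proof. by move=> /intposet_mask[m X0 XE]; exists (mask m s); split=> // q /mem_mask. Qed.

Lemma finite_intposet : finite_set L.
Proof.
apply: (@sub_finite_set _ _ [set flat (mask m s) | m in @setT ((size s).-tuple bool)]).
  by move=> X /intposet_mask[m _ ->]; exists m.
exact/finite_image/finite_finset.
Qed.

Lemma directionP X : L X -> is_direction X (direction X).
Proof.
move=> /intposet_flat[B [_ X0 XE]]; rewrite /direction; case: xgetP => // /(_ (flat_dir B)).
by rewrite {X}XE in X0 * => /(_ (flat_direction X0)).
Qed.

Lemma affdim_proper X Y : L X -> L Y -> X `<` Y -> (affdim X < affdim Y)%N.
Proof.
move=> /directionP dX /directionP dY.
rewrite (is_direction_affdim dX) (is_direction_affdim dY).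
exact: rank_direction_proper.
Qed.

Lemma affdim_le X : L X -> (affdim X <= n)%N.
Proof. by move=> /directionP/is_direction_affdim ->; apply: rank_leq_row. Qed.

Lemma intposetT : L setT.
Proof.
exists set0; split; first by [].
by rewrite bigcap_set0; split=> //; exists 0.
Qed.

(** Every recursive call goes to a flat of larger dimension, so any fuel above the codimension gives
    the same value. *)
Lemma mob_fuel_stable k k' X : L X ->
  (n - affdim X < k)%N -> (n - affdim X < k')%N ->
  mob_fuel L k X = mob_fuel L k' X.
Proof.
elim: k k' X => // k IH [//|k'] X LX kX k'X /=.
case: pselect => // nXT; congr (- _); apply: eq_fsbigr => Y.
move=> /set_mem[LY XY]; have := affdim_proper LX LY XY; have := affdim_le LY.
by move=> dYn dXY; apply: IH => //; lia.
Qed.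

Notation mu := (mobius (arrangement s)).

Lemma mobius_sum X : L X ->
  \sum_(Y \in L `&` [set Y | X `<=` Y]) mu Y = `[< X = setT >]%:R.
Proof.
move=> LX; have [->|XT] := pselect (X = setT).
  have -> : L `&` [set Y | setT `<=` Y] = [set setT].
    apply/seteqP; split=> [Y [_ /= TY]|Y ->]; first by apply/seteqP.
    by split=> //; apply: intposetT.
  by rewrite fsbig_set1 asboolT // /mobius /=; case: pselect.
rewrite (fsbigD1 X) /=; last 2 first.
- exact: sub_finite_set (@subIsetl _ _ _) finite_intposet.
- by split.
rewrite asboolF // /mobius [mob_fuel _ _ X]/=; case: pselect => // nXT.
apply/eqP; rewrite addrC subr_eq0; apply/eqP.
have -> : (L `&` [set Y | X `<=` Y]) `\ X = [set Y | L Y /\ X `<` Y].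
  apply/seteqP; split=> [Y [[LY XY] YX]|Y [LY [XY YX]]]; split=> //.
    by split=> // YX'; apply: YX; apply/seteqP.
  by move=> E; apply: YX; rewrite E.
(* Unfolding at [X] leaves fuel n, enough for [Y], which has positive dimension and hence
   codimension below n. *)
apply: eq_fsbigr => Y; rewrite inE => -[LY XY].
have := affdim_proper LX LY XY; have := affdim_le LY.
by move=> dYn dXY; apply: mob_fuel_stable => //; lia.
Qed.

(** Let [B] list the hyperplanes through x. The flats containing x are those containing [flat B], so
    the sum is the Moebius sum of [flat B]: it is 0 unless [flat B] is the whole space, that is,
    unless no hyperplane passes through x. *)
Lemma mobius_indicator x :
  \sum_(X \in L) mu X * `[< X x >]%:R = `[< complement (arrangement s) x >]%:R.
Proof.
pose B := [seq q <- s | gap q x == q.2].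
have Bx : flat B x by move=> q; rewrite mem_filter => /andP[/eqP].
have LB : L (flat B).
  by apply: flat_intposet; [move=> q; rewrite mem_filter => /andP[]|exists x].
have minB X : L X -> X x <-> flat B `<=` X.
  move=> /intposet_flat[C [Cs _ ->]]; split=> [Cx y By q qC|]; last exact.
  by apply: By; rewrite mem_filter Cs // Cx // eqxx.
have -> : complement (arrangement s) x = (flat B = setT).
  apply/propext; split=> [cx|BT].
    apply/seteqP; split=> // y _ q; rewrite mem_filter => /andP[/eqP qx qs].
    by case: cx; exists (hyperplane q) => //; exists q.
  move=> -[_ [q qs ->] qx].
  (* Since the two indices of q differ, this shift changes the gap by 1 and leaves the
     hyperplane. *)
  have : flat B (delta_mx 0 q.1.1 + x) by rewrite BT.
  move=> /(_ q); rewrite mem_filter qs qx eqxx => /(_ isT).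
  rewrite gapD qx /gap !mxE !eqxx eq_sym (negbTE (s_neq qs)) /=; lra.
rewrite -(mobius_sum LB) fsbig_mkcondr; apply: eq_fsbigr => X /set_mem LX.
have [Xx|nXx] := asboolP (X x); first by rewrite mulr1 mem_set //; apply/(minB _ LX).
by rewrite mulr0 memNset // => /(minB _ LX).
Qed.

End Poset.
End Flats.

(** * Regions and limits along rays *)

Section EventualSign.
Variable R : realType.
Implicit Types a b : R.

Lemma eventually_gt0 a b :
  (exists N0, forall N, (N0 <= N)%N -> 0 < a + N%:R * b) <->
  0 <= b /\ (b = 0 -> 0 < a).
Proof.
split=> [[N0 HN]|[]].
  have bge0 : 0 <= b.
    rewrite leNgt; apply/negP => b0.
    pose N := maxn N0 (Num.bound `|a / - b|).
    have := HN N (leq_maxl _ _); rewrite -[a](@divfK _ (- b)) ?oppr_eq0 ?lt_eqF //.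
    have : a / - b <= N%:R.
      apply: le_trans (ler_norm _) _; apply: le_trans (ltW (archi_boundP _)) _ => //.
      by rewrite ler_nat leq_maxr.
    move: (a / - b) => c cN; nra.
  by split=> // b0; have := HN N0 (leqnn _); rewrite b0 mulr0 addr0.
rewrite le_eqVlt => /orP[/eqP<- /(_ erefl) a0|b0 _].
  by exists 0%N => N _; rewrite mulr0 addr0.
exists (Num.bound `|a / b|) => N; rewrite -(ler_nat R) => N0N.
rewrite -[a](@divfK _ b) ?gt_eqF // -mulrDl pmulr_lgt0 //.
have := lt_le_trans (archi_boundP (normr_ge0 _)) N0N.
have := ler_norm (- (a / b)); rewrite normrN; lra.
Qed.

Lemma eventually_sg a b :
  exists N0, forall N, (N0 <= N)%N -> Num.sg (a + N%:R * b) = Num.sg (a + N0%:R * b).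
Proof.
suff [e [N0 HN]] : exists e, exists N0, forall N, (N0 <= N)%N ->
    Num.sg (a + N%:R * b) = e.
  by exists N0 => N NN; rewrite !HN.
have [b0|b0|->] := ltgtP b 0; last first.
- by exists (Num.sg a), 0%N => N _; rewrite mulr0 addr0.
- have [|N0 HN] := (eventually_gt0 a b).2.
    by split; [exact: ltW|move=> E; rewrite E ltxx in b0].
  by exists 1, N0 => N /HN; apply: gtr0_sg.
- have [|N0 HN] := (eventually_gt0 (- a) (- b)).2.
    by split; [rewrite oppr_ge0 ltW|move=> /eqP; rewrite oppr_eq0 lt_eqF].
  exists (-1), N0 => N /HN H; apply: ltr0_sg; lra.
Qed.

End EventualSign.

Section Cells.
Variables (R : realType) (n : nat).
Notation V := 'rV[R]_n.
Notation hyperplane_index := ('I_n * 'I_n * R)%type.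
Implicit Types (q : hyperplane_index) (s B : seq hyperplane_index).
Implicit Types (x y z v c : V) (X C : set V).

Definition height q x : R := gap q x - q.2.

Lemma height_line q x v a : height q (x + a *: v) = height q x + a * gap q v.
Proof. by rewrite /height gapD gapZ; ring. Qed.

Lemma height_continuous q : continuous (height q).
Proof.
have coordc (i : 'I_n) : continuous (fun x : V => x 0 i) by apply: coord_continuous.
move=> x; exact: (continuousB (continuousB (coordc q.1.1 x) (coordc q.1.2 x))
  (@cst_continuous _ _ q.2 x)).
Qed.

Lemma line_continuous x v : continuous (fun t : R => x + t *: v).
Proof.
move=> t; apply/cvg_ballP => e e0.
have H : \forall u \near t, forall j : 'I_n, ball ((x + t *: v) 0 j) e ((x + u *: v) 0 j).
  apply: (@filter_forall _ _ (fun j u => ball ((x + t *: v) 0 j) e ((x + u *: v) 0 j))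
    _ (nbhs_filter t)) => j.
  have : (fun u : R => (x + u *: v) 0 j) @ t --> (x + t *: v) 0 j.
    rewrite (_ : (fun _ => _) = (fun u => x 0 j + u * v 0 j)); last first.
      by apply/funext => u; rewrite !mxE.
    rewrite !mxE; exact: (cvgD (cvg_cst _) (cvgM cvg_id (cvg_cst _))).
  by move=> /cvg_ballP/(_ e e0).
near=> u; split=> // i j; rewrite [i]ord1; move: j; near: u; exact: H.
Unshelve. all: by end_near.
Qed.

Section Regions.
Variable s : seq hyperplane_index.
Notation D := (complement (arrangement s)).
Notation L := (intposet (arrangement s)).

Lemma complementP x : D x <-> forall q, q \in s -> height q x != 0.
Proof.
split=> [Dx q qs|H [_ [q qs ->]] /= E]; last first.
  by move: (H q qs); rewrite /height E subrr eqxx.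
by rewrite subr_eq0; apply/eqP => E; apply: Dx; exists (hyperplane q) => //; exists q.
Qed.

Definition cell z := [set y | forall q, q \in s -> 0 < height q z * height q y].

Lemma cell_refl z : D z -> cell z z.
Proof. by move=> /complementP H q /H h0; rewrite -expr2 lt_def sqrf_eq0 h0 sqr_ge0. Qed.

Lemma cell_sub z : cell z `<=` D.
Proof.
move=> y zy; apply/complementP => q /zy; apply: contraTneq => ->.
by rewrite mulr0 ltxx.
Qed.

Lemma cell_convex z x y t : cell z x -> cell z y -> 0 <= t -> t <= 1 ->
  cell z (x + t *: (y - x)).
Proof.
move=> zx zy t0 t1 q qs; have := zx q qs; have := zy q qs.
have -> : height q (x + t *: (y - x)) = (1 - t) * height q x + t * height q y.
  by rewrite /height /gap !mxE; ring.
move: (height q x) (height q y) (height q z) => a b h hb ha.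
rewrite mulrDr mulrCA [h * (t * b)]mulrCA.
have [->|tn0] := eqVneq t 0; first by rewrite subr0 mul1r mul0r addr0.
apply: ltr_wpDl; first by rewrite mulr_ge0 ?subr_ge0 // ltW.
by rewrite mulr_gt0 // lt_def tn0.
Qed.

(** A height that changed sign on the component would vanish somewhere on it, by connectedness;
    conversely the segment from x to a point of the convex cell avoids all hyperplanes. *)
Lemma component_cell x : D x -> connected_component D x = cell x.
Proof.
move=> Dx; apply/seteqP; split=> [y xy q qs|y xy].
  rewrite ltNge; apply/negP => xy0.
  have : is_interval (height q @` connected_component D x).
    apply/connected_intervalP/connected_continuous_connected.
      exact: component_connected.
    exact/continuous_subspaceT/height_continuous.
  move=> itv; have hx : (height q @` connected_component D x) (height q x).
    by exists x => //; apply: connected_component_refl.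
  have hy : (height q @` connected_component D x) (height q y) by exists y.
  have [w xw w0] : (height q @` connected_component D x) 0.
    have [h0|h0] := leP 0 (height q x).
      apply: (itv _ _ hy hx); rewrite h0 andbT.
      have := (complementP x).1 Dx q qs; nra.
    by apply: (itv _ _ hx hy); rewrite (ltW h0) /=; nra.
  have := (complementP w).1 (connected_component_sub xw) q qs.
  by rewrite w0 eqxx.
pose S := (fun t : R => x + t *: (y - x)) @` `[0, 1].
have S01 t : 0 <= t -> t <= 1 -> S (x + t *: (y - x)).
  by move=> t0 t1; exists t => //=; rewrite in_itv /= t0.
have Sx : S x by have := S01 0 (lexx _) ler01; rewrite scale0r addr0.
have Sy : S y by have := S01 1 ler01 (lexx _); rewrite scale1r subrKC.
apply: (connected_component_max Sx) Sy.
  move=> _ [t /= + <-]; rewrite in_itv /= => /andP[t0 t1].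
  by apply/(@cell_sub x)/cell_convex => //; apply: cell_refl.
apply: connected_continuous_connected; first exact: segment_connected.
exact/continuous_subspaceT/line_continuous.
Qed.

Lemma region_cell C z : region (arrangement s) C -> C z -> D z /\ C = cell z.
Proof.
move=> [x Dx ->] Cz; have Dz := connected_component_sub Cz.
by split=> //; rewrite -component_cell // (same_connected_component Cz).
Qed.

Lemma cell_region z : D z -> region (arrangement s) (cell z).
Proof. by move=> Dz; exists z => //; rewrite component_cell. Qed.

Lemma region_neq0 C : region (arrangement s) C -> C !=set0.
Proof. by move=> [x Dx ->]; exists x; apply: connected_component_refl. Qed.

Notation Reg := [set C | region (arrangement s) C].

(** Off the hyperplanes, one positivity bit per hyperplane determines the cell. *)
Lemma finite_region : finite_set Reg.
Proof.
pose side z := map_tuple (fun q => 0 < height q z) (in_tuple s).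
apply: (@sub_finite_set _ _
  [set [set z | D z /\ side z = m] | m in @setT ((size s).-tuple bool)]).
  move=> C rC; have [z Cz] := region_neq0 rC; have [Dz ->] := region_cell rC Cz.
  exists (side z) => //; apply/seteqP; split=> y.
    move=> [/complementP Dy E] q qs; have := Dy q qs; have := (complementP z).1 Dz q qs.
    have : (0 < height q y) = (0 < height q z).
      have /eq_in_map/(_ q qs) // : map (fun q => 0 < height q y) s
        = map (fun q => 0 < height q z) s by case: E.
    move: (height q y) (height q z) => a b.
    have [a0|a0|->] := ltgtP a 0; have [b0|b0|->] := ltgtP b 0; rewrite ?eqxx //.
      by rewrite nmulr_rgt0.
    by rewrite pmulr_rgt0.
  move=> zy; split; first exact: cell_sub zy.
  apply/val_inj/eq_in_map => q qs; have := zy q qs.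
  move: (height q y) (height q z) => a b ab; apply/idP/idP => h.
    by rewrite -(pmulr_lgt0 _ h).
  by rewrite -(pmulr_rgt0 _ h).
exact/finite_image/finite_finset.
Qed.

Lemma region_indicator x :
  \sum_(C \in Reg) (`[< C x >]%:R : int) = `[< D x >]%:R.
Proof.
have [Dx|nDx] := asboolP (D x); last first.
  rewrite fsbig1 // => C rC; rewrite asboolF // => Cx.
  by have [] := region_cell rC Cx.
rewrite (fsbigD1 (cell x)) /=; last 2 first.
- exact: finite_region.
- exact: cell_region.
rewrite (asboolT (cell_refl Dx)) fsbig1 ?addr0 // => C [rC Cx].
by rewrite asboolF // => /(region_cell rC)[_ E]; apply: Cx.
Qed.

(** The pointwise limit of the translates X - N c; the threshold may depend on x. *)
Definition ray_limit c X :=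
  [set x : V | exists N0, forall N, (N0 <= N)%N -> X (x + N%:R *: c)].

(** Each product of heights is affine in N along the ray: it is eventually positive iff its slope is
    positive, or its slope is 0 and its constant term positive. *)
Lemma ray_limit_cell c z x : ray_limit c (cell z) x <->
  forall q, q \in s -> 0 <= height q z * gap q c /\
    (height q z * gap q c = 0 -> 0 < height q z * height q x).
Proof.
have E q N : height q z * height q (x + N%:R *: c) =
    height q z * height q x + N%:R * (height q z * gap q c).
  by rewrite height_line; ring.
split=> [[N0 HN] q qs|H].
  by apply/eventually_gt0; exists N0 => N NN; rewrite -E; apply: HN.
have [|N0 HN] := @common_threshold _ s
    (fun q N => 0 < height q z * height q (x + N%:R *: c)).
  move=> q /H /eventually_gt0[N0 HN]; exists N0 => N NN.
  by rewrite E HN.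
by exists N0 => N NN q qs; apply: HN.
Qed.

(** The inequalities say that c is in the recession cone of the cell; the ray from z then stays in
    the cell. *)
Lemma ray_limit_cell_neq0 c z : D z -> ray_limit c (cell z) !=set0 <->
  forall q, q \in s -> 0 <= height q z * gap q c.
Proof.
move=> Dz; split=> [[x /ray_limit_cell H] q /H[]//|H].
exists z; apply/ray_limit_cell => q qs; split; first exact: H.
by move=> _; apply: cell_refl.
Qed.

Lemma ray_limit_region_relopen c C : region (arrangement s) C ->
  ray_limit c C !=set0 -> relopen_convex (ray_limit c C) 1%:M.
Proof.
move=> rC lC0; have [z Cz] := region_neq0 rC; have [Dz CE] := region_cell rC Cz.
split=> // [x y t [N1 xC] [N2 yC] t0 t1|x y _ _|x v]; last 2 first.
- exact: submx1.
- rewrite CE => /ray_limit_cell Hx _.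
  have [|d d0 Hd] := @common_radius R _ s (fun q t => height q z * gap q c = 0 ->
    0 < height q z * height q (x + t *: v)); last first.
    exists d => // t td; apply/ray_limit_cell => q qs.
    by split; [case: (Hx q qs)|exact: Hd].
  move=> q qs; have [_] := Hx q qs.
  have [h0|h0] := eqVneq (height q z * gap q c) 0; last first.
    by move=> _; exists 1 => // t _ h0'; rewrite h0' eqxx in h0.
  move=> /(_ h0) a0.
  (* Below this radius the change of the product is smaller than its value at x; adding 1 keeps the
     denominator positive. *)
  exists (height q z * height q x / (`|height q z * gap q v| + 1)).
    by rewrite divr_gt0 // ltr_wpDl.
  move=> t; rewrite ltr_pdivlMr ?ltr_wpDl // => H _.
  rewrite height_line mulrDr mulrCA.
  have := ler_norm (- (t * (height q z * gap q v))).
  rewrite normrN normrM; move: (normr_ge0 t); nra.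
exists (maxn N1 N2) => N; rewrite geq_max => /andP[/xC {}xC /yC {}yC].
have -> : x + t *: (y - x) + N%:R *: c =
    x + N%:R *: c + t *: (y + N%:R *: c - (x + N%:R *: c)).
  by apply/rowP => i; rewrite !mxE; ring.
by rewrite CE in xC yC *; apply: cell_convex.
Qed.

(** Two consecutive points of the ray in [X] already make c parallel to [X], and then [X] is
    invariant under translation by c. *)
Lemma ray_limit_flat c X : L X -> ray_limit c X !=set0 ->
  (c <= direction X)%MS /\ ray_limit c X = X.
Proof.
move=> LX; have [_ dirX] := directionP LX.
have key x : ray_limit c X x -> (c <= direction X)%MS /\ X x.
  move=> [N HN]; have XN := HN N (leqnn _).
  have XN1 := HN N.+1 (leqnSn _).
  have cX : (c <= direction X)%MS.
    apply/(dirX _ _ XN); have -> // : x + N%:R *: c + c = x + N.+1%:R *: c.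
    by rewrite -addrA -natr1 scalerDl scale1r.
  split=> //; have -> : x = x + N%:R *: c + (- N%:R) *: c.
    by rewrite -addrA -scalerDl subrr scale0r addr0.
  by apply/(dirX _ _ XN)/scalemx_sub.
move=> [x0 /key[cX _]]; split=> //; apply/seteqP; split=> x; first by case/key.
by move=> Xx; exists 0%N => N _; apply/(dirX _ _ Xx)/scalemx_sub.
Qed.

Lemma ray_limit_flat_neq0 c X : L X ->
  ray_limit c X !=set0 <-> (c <= direction X)%MS.
Proof.
move=> LX; split=> [/(ray_limit_flat LX)[]//|cX].
have [[x Xx] dirX] := directionP LX.
by exists x, 0%N => N _; apply/(dirX _ _ Xx)/scalemx_sub.
Qed.

Definition same_face x y := forall q, q \in s -> Num.sg (height q x) = Num.sg (height q y).

Lemma same_face_flat x y X : L X -> same_face x y -> X x <-> X y.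
Proof.
suff W u v : L X -> same_face u v -> X u -> X v.
  by move=> LX xy; split; apply: W => // q /xy.
move=> /intposet_flat[B [Bs _ ->]] uv Bu q qB; have := uv q (Bs q qB).
rewrite {1}/height Bu // subrr sgr0 => /esym/eqP.
by rewrite sgr_eq0 subr_eq0 => /eqP.
Qed.

Lemma same_face_region x y C : region (arrangement s) C -> same_face x y -> C x <-> C y.
Proof.
suff W u v : region (arrangement s) C -> same_face u v -> C u -> C v.
  by move=> LX xy; split; apply: W => // q /xy.
move=> rC uv Cu; have [_ E] := region_cell rC Cu; rewrite E in Cu *.
by move=> q qs; have := Cu q qs; rewrite -!sgr_cp0 !sgrM (uv q qs).
Qed.

(* Far along the ray the face does not change any more, so that the limit
   indicator functions are values at one single point. *)
Lemma ray_limit_eventually c x : exists y,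
  (forall X, L X -> ray_limit c X x <-> X y) /\
  (forall C, region (arrangement s) C -> ray_limit c C x <-> C y).
Proof.
have [N0 HN] : exists N0, forall N, (N0 <= N)%N ->
    same_face (x + N%:R *: c) (x + N0%:R *: c).
  have [|N0 HN] := @common_threshold _ s (fun q N => forall N', (N <= N')%N ->
      Num.sg (height q (x + N'%:R *: c)) = Num.sg (height q (x + N%:R *: c))); last first.
    by exists N0 => N NN q qs; apply: (HN q qs N0).
  move=> q _; have [N0 HN] := eventually_sg (height q x) (gap q c).
  exists N0 => N NN N' NN'; rewrite !height_line HN ?(leq_trans NN) //.
  by rewrite HN.
exists (x + N0%:R *: c).
have W (X : set V) : (forall u v, same_face u v -> X u <-> X v) ->
    ray_limit c X x <-> X (x + N0%:R *: c).
  move=> XW; split=> [[N1 H1]|XN]; last by exists N0 => N /HN /XW ->.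
  by apply/(XW _ _ (HN (maxn N0 N1) (leq_maxl _ _)))/H1/leq_maxr.
by split=> X HX; apply: W => u v; [apply: same_face_flat|apply: same_face_region].
Qed.

Hypothesis s_neq : forall q, q \in s -> q.1.1 != q.1.2.
Notation mu := (mobius (arrangement s)).

(** For c = 0 this is Zaslavsky's formula for the number of regions. *)
Lemma directional_zaslavsky c :
  \sum_(X \in L) mu X * (-1) ^+ affdim X * (c <= direction X)%MS%:R =
  \sum_(C \in Reg) (-1 : int) ^+ n * `[< ray_limit c C !=set0 >]%:R.
Proof.
have fL := finite_intposet s; have fR := finite_region.
have memL X := @mem_fset_set _ L X fL; have memR X := @mem_fset_set _ Reg X fR.
(* Empty limits are filtered out because [relopen_convex] requires nonempty sets; they contribute 0
   to the relation. *)
pose lX := [seq (mu X, ray_limit c X, direction X) |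
  X <- finmap.enum_fset (fset_set L) & `[< ray_limit c X !=set0 >]].
pose lC := [seq (-1 : int, ray_limit c C, 1%:M : 'M[R]_n) |
  C <- finmap.enum_fset (fset_set Reg) & `[< ray_limit c C !=set0 >]].
have := @euler_char_linear R n (lX ++ lC).
rewrite big_cat /= !big_map !big_filter /=.
move=> H; apply/eqP; rewrite -subr_eq0 -[X in _ == X]H; last 2 first.
- move=> q; rewrite mem_cat => /orP[] /mapP[X]; rewrite mem_filter => /andP[/asboolP X0].
    move=> /memL LX -> /=; have [cX ->] := ray_limit_flat LX X0.
    exact: is_direction_relopen (directionP LX).
  by move=> /memR rC -> /=; apply: ray_limit_region_relopen.
- move=> x; rewrite big_cat /= !big_map !big_filter /=.
  have [y [yL yR]] := ray_limit_eventually c x.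
  have := mobius_indicator s_neq y; rewrite -region_indicator !fsbig_finite //.
  move=> /eqP; rewrite -subr_eq0 => /eqP E; rewrite -[RHS]E; congr (_ + _).
    rewrite big_mkcond; apply: eq_big_seq => X /memL LX.
    rewrite -(asbool_equiv_eq (yL X LX)); case: asboolP => // X0.
    by rewrite asboolF ?mulr0 // => Xx; apply: X0; exists x.
  rewrite -sumrN big_mkcond; apply: eq_big_seq => X /memR LX.
  rewrite -(asbool_equiv_eq (yR X LX)) mulN1r; case: asboolP => // X0.
  by rewrite asboolF ?oppr0 // => Xx; apply: X0; exists x.
rewrite !fsbig_finite // -sumrN; apply/eqP; congr (_ + _).
  rewrite [RHS]big_mkcond; apply: eq_big_seq => X /memL LX.
  rewrite (is_direction_affdim (directionP LX)).
  have <- : `[< ray_limit c X !=set0 >] = (c <= direction X)%MS.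
    by apply/asboolP/idP => /(ray_limit_flat_neq0 c LX).
  by case: asboolP => _; rewrite ?mulr1 ?mulr0.
rewrite [RHS]big_mkcond; apply: eq_bigr => C _.
by case: asboolP => _; rewrite ?mulr1 ?mulr0 ?oppr0 // mxrank1 mulN1r.
Qed.

End Regions.
End Cells.

(** * Counting directions *)

Section Blocks.
Variables (R : realType) (n d : nat) (h : 'I_n -> 'I_d) (g : 'I_d -> 'I_n).
Hypothesis gK : cancel g h.

(** Here h numbers the blocks and g picks a representative of each; the row space consists of the
    vectors constant on blocks. *)
Definition block_indicator : 'M[R]_(d, n) := \matrix_(f, k) (h k == f)%:R.

Lemma block_indicatorP (v : 'rV[R]_n) :
  (v <= block_indicator)%MS <-> forall k, v 0 k = v 0 (g (h k)).
Proof.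
split=> [/submxP[u ->] k|H].
  by rewrite !mxE; apply: eq_bigr => f _; rewrite !mxE gK.
apply/submxP; exists (\row_f v 0 (g f)); apply/rowP => k.
rewrite mxE (bigD1 (h k)) //= big1 => [|f fk]; first by rewrite !mxE eqxx mulr1 addr0 H.
by rewrite !mxE eq_sym (negbTE fk) mulr0.
Qed.

Lemma rank_block_indicator : \rank block_indicator = d.
Proof.
apply/eqP; rewrite -[_ == _]/(row_free _); apply/row_freeP.
exists (\matrix_(k, f) (k == g f)%:R); apply/matrixP => f f'.
rewrite mxE (bigD1 (g f')) //= big1 => [|k kf]; last by rewrite !mxE (negbTE kf) mulr0.
by rewrite !mxE gK eqxx mulr1 addr0 eq_sym.
Qed.

Lemma card_block_constant t :
  #|[set c : {ffun 'I_n -> 'I_t} | [forall k, c k == c (g (h k))]]%SET| = (t ^ d)%N.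
Proof.
pose pull (b : {ffun 'I_d -> 'I_t}) := [ffun k => b (h k)].
have pull_inj : injective pull.
  by move=> b b' /ffunP E; apply/ffunP => f; have := E (g f); rewrite !ffunE gK.
rewrite -[RHS](_ : #|[set: {ffun 'I_d -> 'I_t}]%SET| = _)%N; last first.
  by rewrite cardsT card_ffun !card_ord.
rewrite -(card_imset _ pull_inj); apply: eq_card => c; rewrite inE.
apply/forallP/imsetP => [H|[b _ ->] k]; last by rewrite !ffunE gK.
exists [ffun f => c (g f)]; rewrite ?inE //.
by apply/ffunP => k; rewrite !ffunE; apply/eqP.
Qed.

(** Such a c is constant on blocks, so it amounts to a weakly increasing [d]-tuple with entries at
    most t. *)
Lemma card_block_monotone t :
  #|[set c : {ffun 'I_n -> 'I_t.+1} |
      [forall i, forall j, (h i <= h j)%N ==> (c i <= c j)%N]]%SET| = 'C(d + t, d).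
Proof.
pose pull (b : d.-tuple 'I_t.+1) := [ffun k => tnth b (h k)].
have pull_inj : injective pull.
  move=> b b' /ffunP E; apply: eq_from_tnth => f.
  by have := E (g f); rewrite !ffunE gK.
have sortedE (b : d.-tuple 'I_t.+1) :
    sorted leq (map val b) <-> forall f f' : 'I_d, (f <= f')%N -> (tnth b f <= tnth b f')%N.
  have bE (f : 'I_d) : nth 0%N (map val b) f = tnth b f.
    by rewrite (tnth_nth (tnth b f)) (nth_map (tnth b f)) ?size_tuple.
  split=> [sb f f' ff'|H].
    rewrite -!bE; apply: (sorted_leq_nth leq_trans leqnn) => //;
      by rewrite inE size_map size_tuple.
  apply/(sortedP 0%N) => i; rewrite size_map size_tuple => id.
  by have := H (Ordinal (ltnW id)) (Ordinal id) (leqnSn _); rewrite -!bE.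
rewrite -card_sorted_tuples -(card_imset _ pull_inj); apply: eq_card => c; rewrite inE.
apply/forallP/imsetP => [H|[b]]; last first.
  rewrite inE => /sortedE H -> i; apply/forallP => j; apply/implyP => ij.
  by rewrite !ffunE; apply: H.
exists [tuple c (g f) | f < d].
  rewrite inE; apply/sortedE => f f' ff'; rewrite !tnth_mktuple.
  by have /forallP/(_ (g f'))/implyP := H (g f); apply; rewrite !gK.
apply/ffunP => k; rewrite ffunE tnth_mktuple; apply/val_inj/eqP.
have Hk i j : h i = h j -> (c i <= c j)%N.
  by move=> E; have /forallP/(_ j)/implyP := H i; apply; rewrite E.
by rewrite eqn_leq !Hk ?gK.
Qed.

End Blocks.

Lemma equivalence_blocks n (e : rel 'I_n) : symmetric e ->
  exists d (h : 'I_n -> 'I_d) (g : 'I_d -> 'I_n),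
    cancel g h /\ forall i j, (h i == h j) = connect e i j.
Proof.
move=> esym; have csym := sym_connect_sym esym.
pose K := [set fingraph.root e k | k in 'I_n]%SET.
have rK k : fingraph.root e k \in K by apply: imset_f.
exists #|K|, (fun k => enum_rank_in (rK k) (fingraph.root e k)), enum_val.
have hE k : enum_val (enum_rank_in (rK k) (fingraph.root e k)) = fingraph.root e k.
  by rewrite enum_rankK_in.
split=> [f|i j].
  apply: enum_val_inj; rewrite hE.
  by have /imsetP[k _ ->] := enum_valP f; apply: root_root.
by rewrite -(inj_eq enum_val_inj) !hE root_connect.
Qed.

(** The size f of the down-set represents the preorder by natural numbers; h gives the position of f
    k among the sorted distinct values. *)
Lemma total_preorder_blocks n (le : rel 'I_n) :
  reflexive le -> transitive le -> total le ->
  exists d (h : 'I_n -> 'I_d) (g : 'I_d -> 'I_n),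
    cancel g h /\ forall i j, (h i <= h j)%N = le i j.
Proof.
move=> le_refl le_trans le_total.
pose f k := #|[set j | le j k]%SET|.
have fE i j : (f i <= f j)%N = le i j.
  apply/idP/idP => [|ij]; last first.
    by apply/subset_leq_card/fintype.subsetP => k; rewrite !inE => /le_trans; apply.
  apply: contraLR => nij; rewrite -ltnNge; apply: proper_card.
  have ji : le j i by have := le_total i j; rewrite (negbTE nij).
  apply/fintype.properP; split.
    by apply/fintype.subsetP => k; rewrite !inE => /le_trans; apply.
  by exists i; rewrite inE.
pose S := sort leq (undup (map f (enum 'I_n))).
have S_sorted : sorted ltn S.
  by rewrite ltn_sorted_uniq_leq sort_uniq undup_uniq sort_sorted //; apply: leq_total.
have fS k : f k \in S by rewrite mem_sort mem_undup map_f // mem_enum.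
have fiS k : (index (f k) S < size S)%N by rewrite index_mem.
exists (size S), (fun k => Ordinal (fiS k)).
have /choice[g Hg] : forall i : 'I_(size S), exists k, f k = nth 0%N S i.
  move=> i; have : nth 0%N S i \in S by apply: mem_nth.
  by rewrite mem_sort mem_undup => /mapP[k _ ->]; exists k.
exists g; split=> [i|i j]; last first.
  rewrite -fE /=; apply/idP/idP.
    apply: (sorted_leq_index leq_trans leqnn) => //.
    by rewrite sort_sorted //; apply: leq_total.
  apply: contraTT; rewrite -!ltnNge => ji.
  exact: (sorted_ltn_index ltn_trans S_sorted).
apply: val_inj; rewrite /= Hg index_uniq //.
by apply: sorted_uniq S_sorted; [exact: ltn_trans|exact: ltnn].
Qed.

Lemma connect_homo (T : finType) (U : Type) (e : rel T) (r : U -> U -> Prop) (f : T -> U) :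
  (forall u, r u u) -> (forall u v w, r u v -> r v w -> r u w) ->
  (forall i j, e i j -> r (f i) (f j)) ->
  forall i j, connect e i j -> r (f i) (f j).
Proof.
move=> r_refl r_trans ef i _ /connectP[p + ->].
by elim: p i => //= k p IH i /andP[/ef ik /IH]; apply: r_trans.
Qed.

(** A path without repeated vertices has fewer than n edges, each accounting for at most a. *)
Lemma path_distance (R : realType) n (e : rel 'I_n) (y : 'rV[R]_n) (a : R) :
  0 <= a -> (forall i j, e i j -> y 0 i - y 0 j <= a) ->
  forall i j, connect e i j -> y 0 i - y 0 j <= n%:R * a.
Proof.
move=> a0 ya i _ /connectP[p0 + ->] => /shortenP[p ip up _].
have : y 0 i - y 0 (last i p) <= (size p)%:R * a.
  elim: p i ip {up} => [|k p IH] i /=; first by rewrite subrr mul0r.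
  move=> /andP[/ya ik /IH]; rewrite -natr1; lra.
move=> /le_trans; apply; rewrite ler_wpM2r // ler_nat.
have := max_card [in i :: p]; rewrite (card_uniqP up) card_ord /=; lia.
Qed.

Lemma sqnorm_coord (R : realType) n (v : 'rV[R]_n) (r : R) i :
  0 <= r -> sqnorm v <= r ^+ 2 -> `|v 0 i| <= r.
Proof.
move=> r0 vr; rewrite -(@ler_pXn2r _ 2) ?nnegrE ?normr_ge0 // real_normK ?num_real //.
apply: le_trans vr; rewrite /sqnorm (bigD1 i) //= lerDl.
by apply: sumr_ge0 => j _; apply: sqr_ge0.
Qed.

(** Modulo the row space of [M], computed by [cokermx], the ray stays bounded, which forces its
    velocity to vanish there. *)
Lemma ray_near_subspace (R : realType) n l (M : 'M[R]_(l, n)) (r : R) (x c : 'rV[R]_n) :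
  0 < r ->
  (forall N : nat, exists y : 'rV[R]_n, (y <= M)%MS /\ sqnorm (x + N%:R *: c - y) <= r ^+ 2) ->
  (c <= M)%MS.
Proof.
move=> r0 H; rewrite submxE; apply/eqP/rowP => j; rewrite [RHS]mxE.
pose K := cokermx M; pose b := (x *m K) 0 j; pose u := (c *m K) 0 j.
pose S := \sum_i r * `|K i j|.
have bound N : `|b + N%:R * u| <= S.
  have [y [yM yr]] := H N.
  have -> : b + N%:R * u = ((x + N%:R *: c - y) *m K) 0 j.
    have yK : y *m K = 0 by apply/eqP; rewrite -submxE.
    by rewrite mulmxBl yK subr0 mulmxDl -scalemxAl [RHS]mxE [X in _ = _ + X]mxE.
  rewrite mxE; apply: le_trans (ler_norm_sum _ _ _) _; apply: ler_sum => i _.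
  by rewrite normrM ler_wpM2r //; apply: sqnorm_coord => //; apply: ltW.
rewrite -/u; apply/eqP; apply: contraT => u0.
have u_gt0 : 0 < `|u| by rewrite normr_gt0.
pose N := Num.bound ((S + `|b|) / `|u|).
have S0 : 0 <= S by apply: sumr_ge0 => i _; rewrite mulr_ge0 // ltW.
have := archi_boundP (divr_ge0 (addr_ge0 S0 (normr_ge0 b)) (ltW u_gt0)).
rewrite -/N ltr_pdivrMr // => NS.
have := ler_normB (b + N%:R * u) b; rewrite addrC addKr normrM normr_nat.
have := bound N; lra.
Qed.

(** * Directions parallel to a flat and directions receding in a region *)

Section Counting.
Variables (R : realType) (n : nat).
Notation V := 'rV[R]_n.
Notation hyperplane_index := ('I_n * 'I_n * R)%type.
Variables (s : seq hyperplane_index) (a : R).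
Hypothesis a_gt0 : 0 < a.
Hypothesis s_bound : forall q, q \in s -> `|q.2| <= a.
Hypothesis s_top : forall i j : 'I_n, i != j -> (i, j, a) \in s.
Notation D := (complement (arrangement s)).
Notation L := (intposet (arrangement s)).

Definition nat_row t (c : {ffun 'I_n -> 'I_t}) : V := \row_k (c k)%:R.

(** The equations of [X] are the edges of a graph on the coordinates. A vector is parallel to [X]
    iff it is constant on the connected components, so their number is the dimension. *)
Lemma card_flat X t : L X ->
  #|[set c : {ffun 'I_n -> 'I_t} | (nat_row c <= direction X)%MS]%SET| = (t ^ affdim X)%N.
Proof.
move=> LX; have dX := directionP LX; rewrite (is_direction_affdim dX).
have [B [_ X0 XE]] := intposet_flat LX.
pose e : rel 'I_n := fun i j =>
  has (fun q => (q.1 == (i, j)) || (q.1 == (j, i))) B.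
have esym : symmetric e by move=> i j; apply: eq_has => q; rewrite orbC.
have [d [h [g [gK hE]]]] := equivalence_blocks esym.
have dirE (v : V) : (v <= direction X)%MS = (v <= block_indicator R h)%MS.
  apply/idP/idP => [vX|/(block_indicatorP gK) vh].
    apply/(block_indicatorP gK) => k.
    apply: (@connect_homo _ _ e eq (v 0)) => //; first by move=> u w ? ->.
      move=> i j /hasP[[[i' j'] b] qB /= ij].
      have [x Xx] := X0; have := (dX.2 x v Xx).2 vX; rewrite XE in Xx *.
      move=> /(_ _ qB); rewrite gapD (Xx _ qB) /gap /=.
      by case/orP: ij => /eqP[-> ->]; lra.
    by rewrite -hE gK.
  have [x Xx] := X0; apply/(dX.2 x v Xx); rewrite XE in Xx *.
  move=> q qB; rewrite gapD (Xx q qB) /gap (vh q.1.1) (vh q.1.2).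
  have /eqP -> : h q.1.1 == h q.1.2; last by rewrite subrr addr0.
  by rewrite hE connect1 //; apply/hasP; exists q => //; rewrite -surjective_pairing eqxx.
have -> : \rank (direction X) = d.
  rewrite -(rank_block_indicator R gK); apply/eqP; rewrite eqn_leq; apply/andP.
  split; apply: mxrankS; apply/row_subP => i.
    by rewrite -dirE row_sub.
  by rewrite dirE row_sub.
rewrite -(card_block_constant gK t); apply: eq_card => c; rewrite !inE dirE.
apply/idP/forallP => [/(block_indicatorP gK) H k|H].
  by have /eqP := H k; rewrite !mxE eqr_nat.
by apply/(block_indicatorP gK) => k; rewrite !mxE; have /eqP {1}-> := H k.
Qed.

(** Total, but in general not transitive: the total preorder is its closure [connect (close z)]. *)
Definition close (z : V) : rel 'I_n := fun i j => z 0 i - z 0 j < a.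

Lemma close_total z i j : close z i j || close z j i.
Proof.
have := a_gt0; rewrite /close; move: (z 0 i) (z 0 j) => u v a0.
by case: (leP u v) => uv; apply/orP; [left|right]; lra.
Qed.

Lemma close_cell z y : cell s z y -> close z =2 close y.
Proof.
move=> zy i j; rewrite /close; have [->|ij] := eqVneq i j; first by rewrite !subrr.
have := zy _ (s_top ij); rewrite /height /gap /= -![_ < a]subr_lt0.
move: (z 0 i - z 0 j - a) (y 0 i - y 0 j - a) => u v uv.
by apply/idP/idP => ?; nra.
Qed.

(** The hyperplanes with constant a give the inequalities for close pairs. These imply all others: a
    constant is between -a and a, so negative height makes the pair (i, j) close and positive height
    the pair (j, i). *)
Lemma recession_close z (c : V) : D z ->
  (forall q, q \in s -> 0 <= height q z * gap q c) <->
  (forall i j, close z i j -> c 0 i <= c 0 j).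
Proof.
move=> /complementP Dz; split=> [H i j zij|H q qs].
  have [->//|ij] := eqVneq i j.
  have := H _ (s_top ij); rewrite /close in zij; rewrite /height /gap /=.
  move: (c 0 i) (c 0 j) => u v; nra.
have := Dz q qs; have := s_bound qs; rewrite ler_norml => /andP[qa1 qa2].
case: (ltgtP (height q z) 0) => // hz _.
  apply: mulr_le0; first exact: ltW.
  rewrite /gap subr_le0; apply: H; rewrite /close.
  by move: hz; rewrite /height /gap; lra.
apply: mulr_ge0; first exact: ltW.
rewrite /gap subr_ge0; apply: H; rewrite /close.
by move: hz; rewrite /height /gap; lra.
Qed.

(** The level is the number d of classes. Coordinates in one class differ by at most n a on [C], so
    [C] is near the space of class-constant vectors. Conversely a subspace near [C] contains all
    receding directions, and these span that space. *)
Lemma region_level C : region (arrangement s) C ->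
  exists d, [/\ (d <= n)%N, has_level C d & forall t,
    #|[set c : {ffun 'I_n -> 'I_t.+1} | `[< ray_limit (nat_row c) C !=set0 >]]%SET|
      = 'C(d + t, d)].
Proof.
move=> rC; have [z Cz] := region_neq0 rC; have [Dz CE] := region_cell rC Cz.
have [||i j|d [h [g [gK hE]]]] := @total_preorder_blocks n (connect (close z)).
- exact: connect0.
- exact: connect_trans.
- by case/orP: (close_total z i j) => /(@connect1 _ (close z)) ->; rewrite ?orbT.
have recE (c : V) : (forall q, q \in s -> 0 <= height q z * gap q c) <->
    (forall i j, (h i <= h j)%N -> c 0 i <= c 0 j).
  rewrite (recession_close c Dz); split=> H i j.
    rewrite hE; apply: (@connect_homo _ _ (close z) (fun u v => u <= v) (c 0)) => //.
    by move=> u v w; apply: le_trans.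
  by move=> ij; apply: H; rewrite hE connect1.
exists d; split.
- have := leq_card g (can_inj gK); by rewrite !card_ord.
- split.
    exists (block_indicator R h); split; first exact: rank_block_indicator gK.
    pose r : R := n%:R * a.
    have r0 : 0 <= r by rewrite mulr_ge0 // ltW.
    (* The squared distance is at most n r^2, which is below (n r + 1)^2; adding 1 makes the radius
       positive. *)
    exists (n%:R * r + 1); first by rewrite ltr_wpDl // mulr_ge0.
    move=> x; rewrite CE => zx; exists (\row_k x 0 (g (h k))).
    split; first by apply/(block_indicatorP gK) => k; rewrite !mxE gK.
    have xr i j : connect (close z) i j -> x 0 i - x 0 j <= r.
      apply: path_distance; first exact: ltW.
      by move=> {}i {}j; rewrite (close_cell zx) => /ltW.
    have coord k : ((x - \row_k x 0 (g (h k))) 0 k) ^+ 2 <= r ^+ 2.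
      rewrite !mxE -[X in X <= _]real_normK ?num_real // lerXn2r ?nnegrE //.
      have := xr k (g (h k)); rewrite -hE gK leqnn => /(_ isT) H1.
      have := xr (g (h k)) k; rewrite -hE gK leqnn => /(_ isT) H2.
      by rewrite ler_norml; apply/andP; split; lra.
    apply: (@le_trans _ _ (\sum_(i < n) r ^+ 2)).
      by rewrite /sqnorm; apply: ler_sum => i _; apply: coord.
    rewrite sumr_const card_ord -[r ^+ 2 *+ n]mulr_natl.
    have : (0 : R) <= n%:R by [].
    have : n%:R <= n%:R ^+ 2 :> R by rewrite -natrX ler_nat -mulnn; nia.
    move: (n%:R : R) r0 => N r0 NN N0.
    have : N * r ^+ 2 <= N ^+ 2 * r ^+ 2 by rewrite ler_wpM2r // sqr_ge0.
    have : 0 <= N * r by rewrite mulr_ge0.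
    have -> : (N * r + 1) ^+ 2 = N ^+ 2 * r ^+ 2 + 2 * (N * r) + 1 by ring.
    lra.
  move=> k [M [rkM [r r0 near]]].
  have recM (c : V) : (forall i j, (h i <= h j)%N -> c 0 i <= c 0 j) -> (c <= M)%MS.
    move=> /recE Hc; apply: (ray_near_subspace (x := z) r0) => N.
    apply: near; rewrite CE => q qs; have := cell_refl Dz qs; rewrite height_line.
    by have := mulr_ge0 (ler0n R N) (Hc q qs); nra.
  rewrite -(rank_block_indicator R gK) -rkM; apply/mxrankS/row_subP => f.
  (* The indicator of the classes from b upwards is monotone, hence receding; consecutive
     differences are the block indicators. *)
  pose step b : V := \row_k (b <= h k)%N%:R.
  have -> : row f (block_indicator R h) = step f - step f.+1.
    apply/rowP => i; rewrite !mxE.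
    by rewrite -val_eqE /=; case: ltngtP => _; rewrite ?subrr ?subr0.
  have stepM b : (step b <= M)%MS.
    apply: recM => i j ij; rewrite !mxE ler_nat.
    by case: (leqP b (h i)) => // bi; rewrite (leq_trans bi ij).
  by apply: addmx_sub; rewrite ?eqmx_opp.
- move=> t; rewrite -(card_block_monotone gK t); apply: eq_card => c; rewrite !inE.
  rewrite CE; apply/asboolP/forallP.
    move=> /(ray_limit_cell_neq0 _ Dz)/recE H i; apply/forallP => j; apply/implyP => /H.
    by rewrite !mxE ler_nat.
  move=> H; apply/(ray_limit_cell_neq0 _ Dz)/recE => i j ij.
  by rewrite !mxE ler_nat; have /forallP/(_ j)/implyP := H i; apply.
Qed.

End Counting.

(** * Comparing the polynomials *)

Lemma binom_poly_neg (R : realType) l t :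
  (binom_poly R l).[- t.+1%:R] = (-1) ^+ l * 'C(l + t, l)%:R.
Proof.
rewrite /binom_poly hornerZ horner_prod.
have -> : \prod_(i < l) ('X - (i%:R)%:P).[- t.+1%:R] = (-1) ^+ l * ((l + t) ^_ l)%:R :> R.
  elim: l => [|l IH]; first by rewrite big_ord0 ffactn0 mulr1.
  rewrite big_ord_recr /= IH hornerXsubC addSn ffactSS natrM exprS.
  rewrite -addnS natrD; ring.
rewrite -bin_ffact natrM mulrCA; congr (_ * _); rewrite mulrC mulfK //.
Qed.

Lemma poly_eq_neg_nat (R : realType) (p q : {poly R}) :
  (forall t, p.[- t.+1%:R] = q.[- t.+1%:R]) -> p = q.
Proof.
move=> pq; apply/eqP; rewrite -subr_eq0; apply/eqP.
apply: (@roots_geq_poly_eq0 _ _ [seq - t.+1%:R | t <- iota 0 (size (p - q))]).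
- by apply/allP => _ /mapP[t _ ->]; rewrite rootE hornerD hornerN pq subrr.
- rewrite map_inj_uniq ?iota_uniq // => t u /oppr_inj/eqP.
  by rewrite eqr_nat => /eqP[].
- by rewrite size_map size_iota.
Qed.

(** The hypotheses cover both arrangements at once: they ask for a bound a on the constants that
    itself occurs for every ordered pair of distinct indices. *)
Lemma charpoly_level_expansion (R : realType) n (s : seq ('I_n * 'I_n * R)) (a : R) :
  0 < a -> (forall q, q \in s -> q.1.1 != q.1.2) ->
  (forall q, q \in s -> `|q.2| <= a) ->
  (forall i j : 'I_n, i != j -> (i, j, a) \in s) ->
  charpoly (arrangement s) =
    \sum_(l < n.+1) (((-1) ^+ (n - l) * (nregions (arrangement s) l)%:R) *: binom_poly R l).
Proof.
move=> a0 s_neq s_le s_top; apply: poly_eq_neg_nat => t.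
set L := intposet (arrangement s); pose Reg := [set C | region (arrangement s) C].
have fL : finite_set L := finite_intposet s; have fR : finite_set Reg := finite_region s.
pose rays C := #|[set c : {ffun 'I_n -> 'I_t.+1} |
  `[< ray_limit (nat_row R c) C !=set0 >]]%SET|.
(* The middle term counts pairs of a direction and a region in which it recedes. Exchanging the sums
   turns it into the value of [charpoly]; grouping the regions by level gives the right-hand
   side. *)
transitivity ((\sum_(C \in Reg) (-1 : int) ^+ n * (rays C)%:R)%:~R : R).
  have -> : \sum_(C \in Reg) (-1 : int) ^+ n * (rays C)%:R =
      \sum_(X \in L) mobius (arrangement s) X * (-1) ^+ affdim X
        * (t.+1 ^ affdim X)%:R.
    rewrite !fsbig_finite //.
    transitivity (\sum_(c : {ffun 'I_n -> 'I_t.+1}) \sum_(C <- finmap.enum_fset (fset_set Reg))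
        (-1 : int) ^+ n * `[< ray_limit (nat_row R c) C !=set0 >]%:R).
      rewrite exchange_big /=; apply: eq_bigr => C _; rewrite -mulr_sumr; congr (_ * _).
      by rewrite -natr_sum /rays -sum1_card big_mkcond /=; congr (_%:R);
        apply: eq_bigr => c _; rewrite inE; case: ifP.
    transitivity (\sum_(c : {ffun 'I_n -> 'I_t.+1}) \sum_(X <- finmap.enum_fset (fset_set L))
        mobius (arrangement s) X * (-1) ^+ affdim X * (nat_row R c <= direction X)%MS%:R).
      apply: eq_bigr => c _; have := directional_zaslavsky s_neq (nat_row R c).
      by rewrite !fsbig_finite.
    rewrite exchange_big /=; apply: eq_big_seq => X /(mem_fset_set fL) LX.
    rewrite -mulr_sumr -(card_flat _ LX); congr (_ * _).
    by rewrite -natr_sum -sum1_card [in RHS]big_mkcond /=; congr (_%:R);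
      apply: eq_bigr => c _; rewrite inE; case: ifP.
  rewrite /charpoly !fsbig_finite // horner_sum rmorph_sum /=; apply: eq_bigr => X _.
  rewrite hornerZ hornerXn !rmorphM /= -mulrA; congr (_ * _).
  by rewrite rmorphXn rmorphN1 rmorph_nat natrX exprNn.
rewrite fsbig_finite // rmorph_sum horner_sum /=.
have nregionsE l : nregions (arrangement s) l =
    (\sum_(C <- finmap.enum_fset (fset_set Reg)) `[< has_level C l >])%N.
  rewrite /nregions -(fsbig_finite _ _ fR).
  rewrite -[[set C | _]]/(Reg `&` [set C | has_level C l]) fsbig_mkcondr.
  by apply: eq_fsbigr => C _; case: asboolP => lev; [rewrite mem_set|rewrite memNset].
under [RHS]eq_bigr => l _.
  rewrite hornerZ binom_poly_neg nregionsE natr_sum mulr_sumr mulr_suml; over.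
rewrite [RHS]exchange_big /=; apply: eq_big_seq => C /(mem_fset_set fR) rC.
have [d [dn lev raysE]] := region_level a0 s_le s_top rC.
have ltd : (d < n.+1)%N by rewrite ltnS.
(* A region contributes only to the index equal to its level, which is unique. *)
rewrite (bigD1 (Ordinal ltd)) //= big1 ?addr0 => [|l ld]; last first.
  rewrite asboolF ?mulr0 ?mul0r // => lev'; case/negP: ld; apply/eqP/val_inj => /=.
  by apply/eqP; rewrite eqn_leq (lev.2 _ lev'.1) (lev'.2 _ lev.1).
rewrite asboolT // mulr1 /rays raysE rmorphM rmorphXn rmorphN1 rmorph_nat /= mulrA.
by rewrite -exprD subnK.
Qed.

Theorem theorem1p5 (R : realType) (n : nat) (A : seq R)
  (Arr : set (set 'rV[R]_n)) :
  (1 <= n)%N -> (0 < size A)%N ->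
  sorted (fun a b => b < a) A -> all (fun a => 0 < a) A ->
  (Arr = arrC n A \/ Arr = arrCstar n A) ->
  charpoly Arr =
    \sum_(l < n.+1) (((-1) ^+ (n - l) * (nregions Arr l)%:R) *: binom_poly R l).
Proof.
move=> _; case: A => // a A _ sortedA /allP posA ArrE.
have a0 : 0 < a by apply/posA/mem_head.
(* The list is decreasing, so its head is the largest constant. *)
have maxA b : b \in a :: A -> `|b| <= a.
  move=> bA; rewrite gtr0_norm ?posA //; move: bA; rewrite inE => /orP[/eqP->//|bA].
  have gt_trans : transitive (fun u v : R => v < u).
    by move=> u v w vu uw; apply: lt_trans vu.
  by have /allP/(_ b bA)/ltW := order_path_min gt_trans sortedA.
pose pairs := [seq p <- enum {: 'I_n * 'I_n} | p.1 != p.2].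
have pairsP i j : ((i, j) \in pairs) = (i != j) by rewrite mem_filter mem_enum andbT.
pose s1 := [seq (p, b) | p <- pairs, b <- a :: A].
have s1P i j b : ((i, j, b) \in s1) = (i != j) && (b \in a :: A).
  apply/allpairsP/andP => [[[[i' j'] c] /= [pP cA [-> -> ->]]]|[ij bA]].
    by split=> //; rewrite -pairsP.
  by exists ((i, j), b); rewrite /= pairsP.
pose s0 := [seq (p, 0 : R) | p : 'I_n * 'I_n <- enum {: 'I_n * 'I_n} & (p.1 < p.2)%N].
have s0P i j b : ((i, j, b) \in s0) = (i < j)%N && (b == 0).
  apply/mapP/andP => [[[i' j'] + [-> -> ->]]|[ij /eqP->]].
    by rewrite mem_filter => /andP[].
  by exists (i, j) => //; rewrite mem_filter ij mem_enum.
(* [s1] lists the hyperplanes of the starred arrangement; [s0] adds those with constant 0, which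
   also respects the bound a. *)
have ArrS : exists s, [/\ Arr = arrangement s,
    forall q, q \in s -> q.1.1 != q.1.2, forall q, q \in s -> `|q.2| <= a &
    forall i j : 'I_n, i != j -> (i, j, a) \in s].
  case: ArrE => ->; [exists (s0 ++ s1)|exists s1]; split.
  - apply/seteqP; split=> [H [[i [j [ij ->]]]|[i [j [b [ij [bA ->]]]]]]|].
    + by exists (i, j, 0) => //; rewrite mem_cat s0P ij eqxx.
    + by exists (i, j, b) => //; rewrite mem_cat s1P ij bA orbT.
    + move=> _ [[[i j] b] + ->]; rewrite mem_cat s0P s1P.
      move=> /orP[/andP[ij /eqP->]|/andP[ij bA]]; first by left; exists i, j.
      by right; exists i, j, b.
  - move=> [[i j] b]; rewrite mem_cat s0P s1P => /orP[/andP[ij _]|/andP[]//].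
    by apply: contraTneq ij => /= ->; rewrite ltnn.
  - move=> [[i j] b]; rewrite mem_cat s0P s1P => /orP[/andP[_ /eqP->]|/andP[_ /maxA]//].
    by rewrite normr0 ltW.
  - by move=> i j ij; rewrite mem_cat s1P ij mem_head orbT.
  - apply/seteqP; split=> [H [i [j [b [ij [bA ->]]]]]|].
      by exists (i, j, b) => //; rewrite s1P ij bA.
    by move=> _ [[[i j] b] + ->]; rewrite s1P => /andP[ij bA]; exists i, j, b.
  - by move=> [[i j] b]; rewrite s1P => /andP[].
  - by move=> [[i j] b]; rewrite s1P => /andP[_ /maxA].
  - by move=> i j ij; rewrite s1P ij mem_head.
have [s [-> s_neq s_le s_top]] := ArrS.
exact: charpoly_level_expansion a0 s_neq s_le s_top.
Qed.
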